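(* Let $p>1$ and $\lambda\le 0$. For all $\alpha>0$, the equation $$u''-uu'+u|u|^{p-1}-\lambda u=0\quad\text{in }(-\alpha,\alpha)$$ admits no positive solution under the Neumann boundary conditions $u'(-\alpha)=u'(\alpha)=0$.
   Context: A solution on an interval is a real-valued function of class $\mathcal{C}^2$ satisfying the equation in the classical sense; the boundary conditions refer to the values of $u'$ (extended continuously) at $\pm\alpha$. A solution is positive if $u>0$ in $(-\alpha,\alpha)$. *)

(* Defs.v *)
From HB Require Import structures.
From mathcomp Require Import all_boot all_order all_algebra.
From mathcomp Require Import all_classical all_reals all_analysis.

Set Implicit Arguments.
Unset Strict Implicit.
Unset Printing Implicit Defensive.

Import Order.TTheory GRing.Theory Num.Theory.
Import numFieldNormedType.Exports.

Local Open Scope ring_scope.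
Local Open Scope classical_set_scope.

(* A function on the open interval ]a, b[ is represented by a total u : R -> R;
   all the notions below depend only on the values of u inside ]a, b[. *)

Definition C2_on (R : realType) (a b : R) (u : R -> R) : Prop :=
  forall x, x \in `]a, b[%R ->
    [/\ derivable u x 1, derivable u^`() x 1 & {for x, continuous u^`(2)}].

Definition is_solution (R : realType) (p lambda a b : R) (u : R -> R) : Prop :=
  C2_on a b u /\
  (forall x, x \in `]a, b[%R ->
    u^`(2)%classic x - u x * u^`()%classic x
      + u x * `|u x| `^ (p - 1) - lambda * u x = 0).

Definition is_positive_on (R : realType) (a b : R) (u : R -> R) : Prop :=
  forall x, x \in `]a, b[%R -> 0 < u x.

(* The values of u' at the endpoints are those of its continuous extension,
   i.e. the one-sided limits of u' from inside ]a, b[. *)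
Definition neumann (R : realType) (a b : R) (u : R -> R) : Prop :=
  u^`() x @[x --> a^'+] --> (0 : R) /\ u^`() x @[x --> b^'-] --> (0 : R).

(* Main.v *)
(** Since [u > 0] and [lambda <= 0], the derivative [v = u'] satisfies
    [v' < u v] on the open interval, and [v] tends to [0] at both ends.  If
    [v <= 0] somewhere, then [v] has an interior minimum with [v <= 0], where
    [0 = v' < u v <= 0]; hence [v > 0] everywhere.  Then [u] increases, so left
    of the midpoint [c] one has [v' < u(c) v], and [v e^(-u(c) x)] decreases
    there from its limit [0] at the left end, contradicting [v > 0]. *)
Require Import Defs.
From mathcomp Require Import all_boot all_order all_algebra.
From mathcomp Require Import all_classical all_reals all_analysis.
From mathcomp Require Import ring.
Import Order.TTheory GRing.Theory Num.Theory.
Import numFieldNormedType.Exports.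
Local Open Scope ring_scope.
Local Open Scope classical_set_scope.

(** [f] is a total function whose values at [a] and [b] are arbitrary. Replacing them by the limit
    value [0] gives continuity on the closed interval, as the extreme and mean value theorems
    require. *)
Definition zero_ext {R : realType} (a b : R) (f : R -> R) (x : R) : R :=
  if x \in `]a, b[%R then f x else 0.

Lemma zero_ext_in {R : realType} (a b : R) (f : R -> R) (x : R) :
  x \in `]a, b[%R -> zero_ext a b f x = f x.
Proof. by rewrite /zero_ext => ->. Qed.

Lemma zero_ext_near {R : realType} (a b : R) (f : R -> R) (x : R) :
  x \in `]a, b[%R -> \forall y \near x, f y = zero_ext a b f y.
Proof.
move=> xab; near=> y; rewrite zero_ext_in//.
by near: y; exact: near_in_itvoo.
Unshelve. all: by end_near. Qed.

Lemma is_derive_zero_ext {R : realType} (a b : R) (f : R -> R) (x df : R) :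
  x \in `]a, b[%R -> is_derive x 1 f df -> is_derive x 1 (zero_ext a b f) df.
Proof. by move=> xab; apply: near_eq_is_derive; exact: zero_ext_near. Qed.

Lemma is_derive_continuous {R : realType} (f : R -> R) (x df : R) :
  is_derive x 1 f df -> {for x, continuous f}.
Proof. by case=> + _; rewrite derivable1_diffP; exact: differentiable_continuous. Qed.

Lemma continuous_zero_ext {R : realType} (a b : R) (f df : R -> R) : a < b ->
  (forall x, x \in `]a, b[%R -> is_derive x 1 f (df x)) ->
  f x @[x --> a^'+] --> (0 : R) -> f x @[x --> b^'-] --> (0 : R) ->
  {within `[a, b], continuous (zero_ext a b f)}.
Proof.
move=> ab fdf fa fb; apply/(continuous_within_itvP _ ab); split.
- move=> x xab; apply: (is_derive_continuous _ x (df x)).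
  by apply: is_derive_zero_ext => //; exact: fdf.
- rewrite {2}/zero_ext in_itv/= ltxx/=.
  apply: cvg_trans fa; apply: near_eq_cvg; near=> x.
  by rewrite zero_ext_in// in_itv/=; apply/andP; split.
- rewrite {2}/zero_ext in_itv/= ltxx andbF.
  apply: cvg_trans fb; apply: near_eq_cvg; near=> x.
  by rewrite zero_ext_in// in_itv/=; apply/andP; split.
Unshelve. all: by end_near. Qed.

(** A point with [v <= 0] forces the minimum over []a, b[] to be attained inside, with value at most
    [0]; there the derivative vanishes, against the second hypothesis. *)
Lemma pos_of_interior_min {R : realType} (a b : R) (v dv : R -> R) : a < b ->
  (forall x, x \in `]a, b[%R -> is_derive x 1 v (dv x)) ->
  (forall x, x \in `]a, b[%R -> v x <= 0 -> dv x != 0) ->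
  v x @[x --> a^'+] --> (0 : R) -> v x @[x --> b^'-] --> (0 : R) ->
  forall x, x \in `]a, b[%R -> 0 < v x.
Proof.
move=> ab vdv dv0 va vb x xab; rewrite ltNge; apply/negP => vx0.
have oc y : y \in `]a, b[%R -> y \in `[a, b]%R by exact: subset_itv_oo_cc.
have [m mab vm] := EVT_min (ltW ab) (continuous_zero_ext _ _ _ _ ab vdv va vb).
have [c cab vc] : exists2 c, c \in `]a, b[%R &
    forall t, t \in `]a, b[%R -> v c <= v t.
  have [moo|mNoo] := boolP (m \in `]a, b[%R).
    by exists m => // t tab; have := vm t (oc t tab); rewrite !zero_ext_in.
  (* If the minimum of the extension sits at an endpoint, its value is [0]. Then [v t >= 0 >= v x]
     for all interior [t], so [x] itself is an interior minimum. *)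
  exists x => // t tab; have := vm t (oc t tab).
  by rewrite {1}/zero_ext (negPf mNoo) zero_ext_in//; exact: le_trans.
have /negP := dv0 c cab (le_trans (vc x xab) vx0); apply.
have dv' := vdv c cab.
have v'0 : is_derive c 1 v 0.
  by apply: (derive1_at_min (ltW ab)) => // t /vdv[].
by rewrite -(@derive_val _ _ _ _ _ _ _ dv') (@derive_val _ _ _ _ _ _ _ v'0).
Qed.

Lemma neumann_supersolution_false {R : realType} (a b : R) (u v dv : R -> R) :
  a < b ->
  (forall x, x \in `]a, b[%R -> 0 < u x) ->
  (forall x, x \in `]a, b[%R -> is_derive x 1 u (v x)) ->
  (forall x, x \in `]a, b[%R -> is_derive x 1 v (dv x)) ->
  (forall x, x \in `]a, b[%R -> dv x < u x * v x) ->
  v x @[x --> a^'+] --> (0 : R) -> v x @[x --> b^'-] --> (0 : R) -> False.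
Proof.
move=> ab u0 uv vdv dvuv va vb.
have v0 x : x \in `]a, b[%R -> 0 < v x.
  apply: (pos_of_interior_min a b v dv) => // y yab vy0.
  rewrite lt_eqF// (lt_le_trans (dvuv y yab))//.
  by rewrite pmulr_rle0// u0.
(* The point [c] must be interior: nothing bounds [u] near [b], whereas [u c] bounds the increasing
   [u] on []a, c[]. *)
pose c := (a + b) / 2.
have [ac cb] := midf_lt ab; rewrite -/c in ac cb.
have cab : c \in `]a, b[%R by rewrite in_itv/= ac.
have sub x : x \in `]a, c[%R -> x \in `]a, b[%R.
  by rewrite !in_itv/= => /andP[-> /lt_trans->].
have uc x : x \in `]a, c[%R -> u x <= u c.
  move=> xac; have := xac; rewrite in_itv/= => /andP[ax xc].
  have sub' y : y \in `[x, c]%R -> y \in `]a, b[%R.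
    rewrite !in_itv/= => /andP[xy yc].
    by rewrite (lt_le_trans ax)// (le_lt_trans yc).
  have uv' y : y \in `]x, c[%R -> is_derive y 1 u (v y).
    by move=> /subset_itv_oo_cc/sub'; exact: uv.
  have cu : {within `[x, c], continuous u}.
    by apply: derivable_within_continuous => y /sub' /uv[].
  have [y yxc uE] := MVT xc uv' cu.
  rewrite -subr_ge0 uE mulr_ge0 ?subr_ge0 ?(ltW xc)// ltW// v0//.
  exact/sub'/subset_itv_oo_cc.
pose V := zero_ext a b v.
(* Integrating factor for [v' < u(c) v]: the derivative of [v E] is [E (v' - u(c) v)]. *)
pose E (x : R) := expR (- u c * x).
have dE (x : R) : is_derive x 1 E (- u c * E x).
  have dl : is_derive x 1 (fun y : R => - u c * y) (- u c).
    by apply: is_derive_eq; rewrite scaler1.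
  rewrite [X in is_derive _ _ _ X]mulrC.
  exact: (is_derive1_comp (is_derive_expR (- u c * x)) dl).
have dVE x : x \in `]a, c[%R ->
    is_derive x 1 (V * E) (v x * (- u c * E x) + E x * dv x).
  move=> /sub xab.
  have dV := is_derive_zero_ext a b v x (dv x) xab (vdv x xab).
  by have := is_deriveM dV (dE x); rewrite zero_ext_in.
have cVE : {within `[a, c], continuous (V * E)}.
  move=> x; apply: cvgM.
    apply: (continuous_subspaceW _ (continuous_zero_ext a b v dv ab vdv va vb)).
    by apply: subset_itvl; rewrite bnd_simp ltW.
  apply: continuous_subspaceT => y.
  exact: (is_derive_continuous E y (- u c * E y)).
(* Since [V a = 0], the mean value theorem equates [V c * E c > 0] with [c - a > 0] times the
   derivative of [V * E] at [x], which is negative. *)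
have [x xac] := MVT ac dVE cVE.
rewrite -[(V * E) c]/(V c * E c) -[(V * E) a]/(V a * E a).
rewrite [V c]zero_ext_in// [V a]/V/zero_ext in_itv/= ltxx/= mul0r subr0.
apply/eqP; rewrite gt_eqF//.
rewrite (@lt_trans _ _ 0)//; last by rewrite mulr_gt0 ?expR_gt0 ?v0.
rewrite pmulr_llt0 ?subr_gt0//.
rewrite [X in X < _](_ : _ = E x * (dv x - u c * v x)); last by ring.
rewrite pmulr_rlt0 ?expR_gt0// subr_lt0 (lt_le_trans (dvuv x (sub x xac)))//.
by rewrite ler_wpM2r ?uc// ltW// v0// sub.
Qed.

Theorem theorem2p11 (R : realType) (p lambda : R) (hp : 1 < p)
    (hlambda : lambda <= 0) (alpha : R) (halpha : 0 < alpha) :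
  ~ exists u : R -> R,
      [/\ is_solution p lambda (- alpha) alpha u,
          is_positive_on (- alpha) alpha u &
          neumann (- alpha) alpha u].
Proof.
move=> [u [[uC2 ueq] u0 [ua ub]]].
apply: (neumann_supersolution_false (- alpha) alpha u u^`() u^`(2)) => //.
- by rewrite gtrN.
- by move=> x /uC2[ux _ _]; rewrite derive1E; exact: derivableP.
- by move=> x /uC2[_ ux _]; rewrite [X in is_derive _ _ _ X]derive1E; exact: derivableP.
- move=> x xa; rewrite -subr_lt0; have := ueq x xa.
  have ux := u0 x xa.
  (* The equation reads [u'' - u u' = -(u |u|^(p-1) - lambda u)]. In the bracket the power term is
     positive and [- lambda u] is nonnegative. *)
  move/eqP; rewrite -addrA addr_eq0 => /eqP->.
  rewrite oppr_lt0 ltr_wpDr//; last by rewrite mulr_gt0// powR_gt0// normr_gt0 gt_eqF.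
  by rewrite oppr_ge0 mulr_le0_ge0// ltW.
Qed.
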